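(* Let $(\lambda_k)_{k\ge 1}$ be a nondecreasing sequence of positive real numbers tending to infinity with $\lambda_1=1$ and $\lambda_{k+1}\le\lambda_k+1$ for all $k$, and let $p=(p_k)_{k\ge1}$ be a bounded sequence of real numbers with $p_k>1$ for all $k$. Then the space $V_\rho(\lambda;p)$ is a Banach space with respect to the Luxemburg norm $$\|x\|_L=\inf\left\{\sigma>0:\ \rho\left(\frac{x}{\sigma}\right)\le1\right\}.$$
   Context: $\ell^0$ denotes the space of all real sequences $x=(x(j))_{j\ge1}$, with coordinatewise operations. For each $k\ge1$, $I_k=[k-\lambda_k+1,k]$, and $j\in I_k$ means that $j$ is a positive integer with $k-\lambda_k+1\le j\le k$. Define $\rho:\ell^0\to[0,\infty]$ by $$\rho(x)=\sum_{k=1}^{\infty}\left(\frac{1}{\lambda_k}\sum_{j\in I_k}|x(j)|\right)^{p_k},$$ and $$V_\rho(\lambda;p)=\{x\in\ell^0:\ \rho(\sigma x)<\infty\text{ for some }\sigma>0\}.$$ *)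

(* Defs.v *)
From HB Require Import structures.
From mathcomp Require Import all_boot all_order all_algebra.
From mathcomp Require Import all_classical all_reals all_analysis.

Set Implicit Arguments.
Unset Strict Implicit.
Unset Printing Implicit Defensive.

Import Order.TTheory GRing.Theory Num.Theory.
Import numFieldNormedType.Exports.

Local Open Scope classical_set_scope.
Local Open Scope ring_scope.

(* Sequences indexed by the integers >= 1 are functions on [nat]. For the
   parameters lambda and p the value at 0 is never used; for the elements of
   l^0 it is fixed to 0, so that distinct elements of [ell0] are distinct
   sequences (x(j))_{j >= 1}. *)
Definition ell0 (R : realType) : set (nat -> R) := [set x | x 0%N = 0].

Definition I_ (R : realType) (lambda : nat -> R) (k : nat) : pred nat :=
  [pred j : nat | [&& (1 <= j)%N, k%:R - lambda k + 1 <= j%:R & (j <= k)%N]].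

Definition rho (R : realType) (lambda p : nat -> R) (x : nat -> R) : \bar R :=
  (\sum_(1 <= k <oo)
    (((lambda k)^-1 * \sum_(j < k.+1 | I_ lambda k j) `|x j|) `^ p k)%:E)%E.

Definition V_rho (R : realType) (lambda p : nat -> R) : set (nat -> R) :=
  [set x | ell0 x /\
     exists sigma : R, 0 < sigma /\ (rho lambda p (sigma *: x) < +oo)%E].

(* The infimum is taken in the extended reals, so that it is +oo when no sigma
   is admissible. *)
Definition luxemburg (R : realType) (lambda p : nat -> R) (x : nat -> R) :
    \bar R :=
  ereal_inf [set sigma%:E | sigma in
    [set sigma : R | 0 < sigma /\ (rho lambda p (sigma^-1 *: x) <= 1)%E]].

(* V is a linear subspace of E on which N is finite, is a norm, and is
   complete: the inclusion of V into E is, up to the choice of a carrier type W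
   for V, an injective linear map with image V along which N pulls back to the
   norm of W. *)
Definition banach_space_for (R : realType) (E : lmodType R) (V : set E)
    (N : E -> \bar R) : Prop :=
  exists (W : completeNormedModType R) (f : {linear W -> E}),
    [/\ injective f, range f = V & forall w : W, N (f w) = (`|w|)%:E].

(* Main.v *)
Require Import Defs.
From HB Require Import structures.
From mathcomp Require Import all_boot all_order all_algebra.
From mathcomp Require Import all_classical all_reals all_analysis.

Import Order.TTheory GRing.Theory Num.Theory.
Import numFieldNormedType.Exports.

Set Implicit Arguments.
Unset Strict Implicit.
Unset Printing Implicit Defensive.

Local Open Scope classical_set_scope.
Local Open Scope ring_scope.

(** Only two features of rho are used: each window mean
      window_mean k x = lambda_k^-1 * sum_(j in I_k) |x(j)|
    is a seminorm depending on finitely many coordinates, and it is raised to a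
    power p_k >= 1. Hence the unit ball B = [rho <= 1] is convex and symmetric.
    It is closed under coordinatewise convergence, because rho <= 1 is a
    condition on the finite partial sums of the series, each of which is
    continuous in finitely many coordinates. It is coordinatewise bounded:
    every term of the series is at most 1, so window_mean k x <= 1 on B, and k
    itself lies in I_k (as lambda_k >= lambda_1 = 1), so |x(k)| <= lambda_k.

    The Luxemburg norm is the Minkowski gauge of B, and V_rho is the linear span
    of B: convexity and rho 0 = 0 give rho (t x) <= t * rho x for t in [0, 1],
    so a vector of finite modular can be shrunk into B ([V_rhoE], [luxemburgE]).

    What remains is a general fact about a convex symmetric set B of real
    functions that is coordinatewise bounded and coordinatewise closed (here
    [banach_disc]): its span, normed by its gauge, is a Banach space
    ([banach_space_for_gauge]). Convexity and symmetry make the gauge a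
    seminorm; boundedness says that the gauge dominates every coordinate, so it
    is a norm and a Cauchy filter converges coordinatewise; closedness upgrades
    this to convergence in norm, since the inequality gauge (w - v) < e, i.e.
    (w - v) / e in B, survives the passage to the limit in v
    ([disc_space_complete]). *)

(** * Normed spaces spanned by a disc *)

(** In the product topology the last two axioms say that the set is compact.
    Closedness is phrased with filters, so that it applies directly to the Cauchy
    filters in terms of which completeness is defined. *)
Record banach_disc (R : realType) (T : Type) := BanachDisc {
  disc_set :> (T -> R) -> Prop;
  disc_set0 : disc_set 0;
  disc_setN : forall x, disc_set x -> disc_set (- x);
  disc_set_convex : forall (t : R) x y, 0 <= t <= 1 ->
    disc_set x -> disc_set y -> disc_set (t *: x + (1 - t) *: y);
  disc_set_bounded : forall j, exists2 c, 0 <= c &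
    forall x, disc_set x -> `|x j| <= c;
  disc_set_closed : forall (F : set_system (T -> R)) x, ProperFilter F ->
    F disc_set -> (forall j, (fun y => y j) @ F --> x j) -> disc_set x }.

Section gauge.
Context {R : realType} {T : Type} (B : banach_disc R T).
Implicit Types (x y : T -> R) (s t : R).

Definition disc_radii x : set R := [set s | 0 < s /\ B (s^-1 *: x)].

(** The union of the dilates of B; it is the linear span of B because B is
    convex and symmetric. *)
Definition disc_span : {pred T -> R} := fun x => `[< disc_radii x !=set0 >].

Definition gauge x : R := inf (disc_radii x).

Lemma disc_spanP x : reflect (disc_radii x !=set0) (x \in disc_span).
Proof. exact: asboolP. Qed.

Lemma disc_radii_lb x : has_lbound (disc_radii x).
Proof. by exists 0 => s [/ltW]. Qed.

Lemma gauge_le x s : disc_radii x s -> gauge x <= s.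
Proof. exact: (ge_inf (disc_radii_lb x)). Qed.

Lemma gauge_ge0 x : x \in disc_span -> 0 <= gauge x.
Proof. by move=> /disc_spanP x0; apply: lb_le_inf => // s [/ltW]. Qed.

Lemma disc_set_scale t x : 0 <= t <= 1 -> B x -> B (t *: x).
Proof.
move=> t01 Bx; have := disc_set_convex t01 Bx (disc_set0 B).
by rewrite scaler0 addr0.
Qed.

(** The admissible radii form an up-closed set because B is star-shaped about 0;
    so every number above the infimum is one. *)
Lemma gauge_lt x s : x \in disc_span -> gauge x < s -> disc_radii x s.
Proof.
move=> /disc_spanP x0 /(inf_lt x0)[r [r0 Br] rs].
have s0 := lt_trans r0 rs; split=> //.
rewrite (_ : s^-1 *: x = (r / s) *: (r^-1 *: x)).
  apply: disc_set_scale => //; rewrite divr_ge0 ?(ltW r0) ?(ltW s0)//=.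
  by rewrite ler_pdivrMr// mul1r ltW.
by rewrite scalerA mulrAC divff ?gt_eqF// mul1r.
Qed.

(** (x + y) / (s + t) is the convex combination of x / s and y / t with weights
    s / (s + t) and t / (s + t). *)
Lemma disc_radiiD x y s t :
  disc_radii x s -> disc_radii y t -> disc_radii (x + y) (s + t).
Proof.
move=> [s0 Bx] [t0 By]; have st0 : 0 < s + t by rewrite addr_gt0.
split=> //.
have l01 : 0 <= s / (s + t) <= 1.
  rewrite divr_ge0 ?(ltW s0) ?(ltW st0)//=.
  by rewrite ler_pdivrMr// mul1r lerDl ltW.
have := disc_set_convex l01 Bx By.
have -> : 1 - s / (s + t) = t / (s + t).
  by rewrite -[X in X - _](@divff _ (s + t)) ?gt_eqF// -mulrBl addrAC subrr add0r.
rewrite !scalerA (mulrAC s) (mulrAC t) !divff ?gt_eqF// !mul1r.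
by rewrite scalerDr.
Qed.

Lemma disc_radiiZ x a s :
  a != 0 -> disc_radii x s -> disc_radii (a *: x) (`|a| * s).
Proof.
move=> a0 [s0 Bx]; split; first by rewrite mulr_gt0 ?normr_gt0.
rewrite scalerA invfM mulrAC; case: (ltgtP a 0) a0 => // ha _.
  rewrite ltr0_norm// invrN mulNr mulVf ?lt_eqF// mulN1r scaleNr.
  exact: disc_setN.
by rewrite gtr0_norm// mulVf ?gt_eqF// mul1r.
Qed.

Lemma disc_radii0 s : 0 < s -> disc_radii 0 s.
Proof. by move=> s0; split=> //; rewrite scaler0; exact: disc_set0. Qed.

Lemma disc_span_submod_closed : submod_closed disc_span.
Proof.
split; first by apply/disc_spanP; exists 1; exact: disc_radii0.
move=> a x y /disc_spanP[s xs] /disc_spanP[t yt]; apply/disc_spanP.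
have [->|a0] := eqVneq a 0; first by exists t; rewrite scale0r add0r.
by exists (`|a| * s + t); apply: disc_radiiD => //; exact: disc_radiiZ.
Qed.

HB.instance Definition _ := GRing.isSubmodClosed.Build R (T -> R) disc_span
  disc_span_submod_closed.

Lemma gaugeD x y : x \in disc_span -> y \in disc_span ->
  gauge (x + y) <= gauge x + gauge y.
Proof.
move=> xB yB; apply/ler_addgt0Pl => e e0.
have e20 : 0 < e / 2 by rewrite divr_gt0.
rewrite [e]splitr [leRHS]addrC [leRHS]addrACA; apply: gauge_le; apply: disc_radiiD.
  by apply: gauge_lt => //; rewrite ltrDl.
by apply: gauge_lt => //; rewrite ltrDl.
Qed.

Lemma gaugeZ a x : x \in disc_span -> gauge (a *: x) = `|a| * gauge x.
Proof.
have gaugeZ_le b y : b != 0 -> y \in disc_span ->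
    gauge (b *: y) <= `|b| * gauge y.
  move=> b0 yB; rewrite -ler_pdivrMl ?normr_gt0//.
  apply/ler_addgt0Pl => e e0; rewrite ler_pdivrMl ?normr_gt0// addrC.
  by apply/gauge_le/disc_radiiZ => //; apply: gauge_lt; rewrite // ltrDl.
(* The converse inequality is gaugeZ_le for the scalar a^-1. *)
move=> xB; have [->|a0] := eqVneq a 0.
  rewrite scale0r normr0 mul0r; apply/eqP; rewrite eq_le gauge_ge0 ?rpred0//.
  rewrite andbT; apply/ler_addgt0Pl => e e0; rewrite addr0.
  exact/gauge_le/disc_radii0.
apply/eqP; rewrite eq_le gaugeZ_le//= -ler_pdivlMl ?normr_gt0//.
rewrite -normfV -{1}[x](scalerK a0); apply: gaugeZ_le; first by rewrite invr_eq0.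
exact: rpredZ.
Qed.

(** Boundedness of B makes every coordinate a continuous functional for the
    gauge. This separates points and turns Cauchy filters into coordinatewise
    Cauchy ones. The constant is made positive so that one can divide by it. *)
Lemma disc_span_coord_le j : exists2 c, 0 < c &
  forall x, x \in disc_span -> `|x j| <= c * gauge x.
Proof.
have [c c0 cB] := disc_set_bounded B j; have c1 : 0 < c + 1 by rewrite ltr_wpDl.
exists (c + 1) => // x xB; rewrite -ler_pdivrMl//; apply/ler_addgt0Pl => e e0.
rewrite [leRHS]addrC; have [s0 Bx] : disc_radii x (gauge x + e).
  by apply: gauge_lt; rewrite // ltrDl.
have := cB _ Bx; rewrite [_ j]/(_ * x j) normrM gtr0_norm ?invr_gt0//.
rewrite ler_pdivrMl// ler_pdivrMl// => /le_trans; apply.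
by rewrite mulrC ler_wpM2r ?(ltW s0)// lerDl.
Qed.

Lemma gauge_eq0 x : x \in disc_span -> gauge x = 0 -> x = 0.
Proof.
move=> xB g0; apply/funext => j; have [c _ /(_ _ xB)] := disc_span_coord_le j.
by rewrite g0 mulr0 normr_le0 => /eqP.
Qed.

(** The span as a type of its own, so that it can carry the topology of the gauge
    instead of that of the ambient function space. *)
Definition disc_space := {x : T -> R | x \in disc_span}.

HB.instance Definition _ := SubType.on disc_space.
HB.instance Definition _ := [Choice of disc_space by <:].
HB.instance Definition _ := [SubChoice_isSubLmodule of disc_space by <:].

Let norm (w : disc_space) := gauge (val w).

Let ler_normD v w : norm (v + w) <= norm v + norm w.
Proof. by apply: gaugeD; exact: valP. Qed.

Let normrZ a w : norm (a *: w) = `|a| * norm w.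
Proof. by apply: gaugeZ; exact: valP. Qed.

Let normr0_eq0 w : norm w = 0 -> w = 0.
Proof. by move=> w0; apply/val_inj/gauge_eq0 => //; exact: valP. Qed.

HB.instance Definition _ :=
  Lmodule_isNormed.Build R disc_space ler_normD normrZ normr0_eq0.

Lemma disc_normE (w : disc_space) : `|w| = gauge (val w).
Proof. by []. Qed.

(** The coordinatewise limit x of F is the limit in norm: if F charges the ball
    of centre w and radius e, then (w - v) / e lies in B for F-most v, and hence
    (w - x) / e lies in B by closedness. *)
Lemma disc_space_complete (F : set_system disc_space) :
  ProperFilter F -> cauchy F -> cvg F.
Proof.
move=> FF /cauchyP Fc.
have coord_cvg j : cvg ((fun w : disc_space => val w j) @ F).
  apply: R_complete; apply: cauchy_exP => e e0.
  have [c c0 cB] := disc_span_coord_le j.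
  have [w Fw] := Fc _ (divr_gt0 e0 c0); exists (val w j).
  apply: (@filterS _ F _ _ _ _ Fw) => v; rewrite -ball_normE /= disc_normE.
  rewrite lter_pdivlMr// mulrC; apply: le_lt_trans.
  by have := cB _ (valP (w - v)).
pose x j := lim ((fun w : disc_space => val w j) @ F).
have near_lim (w : disc_space) e : 0 < e -> F (ball w e) ->
    disc_radii (val w - x) e.
  move=> e0 Fw; split=> //.
  apply: (@disc_set_closed _ _ B ((fun v => e^-1 *: (val w - val v)) @ F)).
    apply: (@filterS _ F _ _ _ _ Fw) => v; rewrite -ball_normE /= disc_normE.
    by move=> /(gauge_lt (valP (w - v)))[].
  move=> j.
  suff: e^-1 * (val w j - val v j) @[v --> F] --> e^-1 * (val w j - x j) by [].
  by apply: cvgM; [exact: cvg_cst|apply: cvgB; [exact: cvg_cst|exact: coord_cvg]].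
have [w1 /(near_lim _ _ ltr01) w1x] := Fc 1 ltr01.
have xB : x \in disc_span.
  rewrite -[x](subKr (val w1)) rpredB ?(valP w1)//.
  by apply/disc_spanP; exists 1.
apply/cvg_ex; exists (exist _ x xB : disc_space).
apply/cvgrPdist_le => e e0.
have e20 : 0 < e / 2 by rewrite divr_gt0.
have [w Fw] := Fc _ e20; have /gauge_le wx := near_lim _ _ e20 Fw.
apply: (@filterS _ F _ _ _ _ Fw) => v; rewrite -ball_normE /= => /ltW wv.
rewrite [e]splitr; apply: le_trans (ler_distD w _ _) _.
by apply: lerD => //; rewrite distrC.
Qed.

HB.instance Definition _ :=
  Uniform_isComplete.Build disc_space disc_space_complete.

End gauge.

Lemma banach_space_for_gauge (R : realType) (T : Type) (B : banach_disc R T)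
    (V : set (T -> R)) (N : (T -> R) -> \bar R) :
  (forall x, V x <-> x \in disc_span B) ->
  (forall x, V x -> N x = (gauge B x)%:E) ->
  banach_space_for V N.
Proof.
move=> VB NB; exists (disc_space B : completeNormedModType R), val; split=> //.
  apply/seteqP; split=> [_ [w _ <-]|x /VB xB]; first exact/VB/valP.
  by exists (exist _ x xB).
by move=> w; rewrite NB//; exact/VB/valP.
Qed.

(** * Real powers *)

Section powR_facts.
Context {R : realType}.
Implicit Types (a b t q : R).

Lemma powR_convex_comb t a b q : 0 <= t <= 1 -> 0 <= a -> 0 <= b -> 1 <= q ->
  (t * a + (1 - t) * b) `^ q <= t * a `^ q + (1 - t) * b `^ q.
Proof.
move=> t01 a0 b0 q1.
have := @convex_powR R q q1 (Itv01 (proj1 (andP t01)) (proj2 (andP t01))) a b.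
rewrite !convRE/= => -> //; by rewrite inE/= in_itv/= andbT.
Qed.

(** The restriction to nonnegative u is essential: the power function is
    constantly 1 on the negative numbers, so it is discontinuous at 0. *)
Lemma cvg_powR_ge0 (I : Type) (F : set_system I) (u : I -> R) a q :
  ProperFilter F -> 0 < q -> (forall i, 0 <= u i) ->
  u @ F --> a -> (u i) `^ q @[i --> F] --> a `^ q.
Proof.
move=> FF q0 u0 ua.
have a0 : 0 <= a by apply: (cvgr_to_ge ua); exact: nearW.
move: a0; rewrite le_eqVlt => /predU1P[a0|a0]; last first.
  apply: (@continuous_cvg _ _ _ F _ u (fun a => a `^ q) a) => //.
  apply: differentiable_continuous.
  by apply/derivable1_diffP/derivable_powR; rewrite in_itv/= a0.
(* At a = 0, the bound u i < e `^ q^-1 suffices for u i `^ q < e. *)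
rewrite -a0 powR0 ?gt_eqF//; apply/cvgrPdist_lt => e e0.
have d0 : 0 < e `^ q^-1 by rewrite powR_gt0.
move: ua; rewrite -a0 => /cvgrPdist_lt/(_ _ d0); apply: filterS => i.
rewrite !sub0r !normrN !ger0_norm ?powR_ge0// => ui.
have -> : e = (e `^ q^-1) `^ q by rewrite -powRrM mulVf ?gt_eqF// powRr1// ltW.
by apply: gt0_ltr_powR; rewrite // nnegrE ?powR_ge0.
Unshelve. all: by end_near. Qed.

End powR_facts.

(** * The unit ball of the modular is a Banach disc *)

Section modular.
Context {R : realType} (lambda p : nat -> R).
Hypothesis lambda_ge1 : forall k, (1 <= k)%N -> 1 <= lambda k.
Hypothesis p_ge1 : forall k, (1 <= k)%N -> 1 <= p k.
Implicit Types (x y : nat -> R).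

Definition window_mean k x : R :=
  (lambda k)^-1 * \sum_(j < k.+1 | I_ lambda k j) `|x j|.

Definition rho_partial n x : R :=
  \sum_(1 <= k < n) window_mean k x `^ p k.

Let lambda_gt0 k : (1 <= k)%N -> 0 < lambda k.
Proof. by move=> /lambda_ge1; exact: lt_le_trans. Qed.

(** A bound on rho is a family of conditions on finitely many coordinates each;
    this is what makes the unit ball coordinatewise closed. *)
Lemma rho_leP x M : (rho lambda p x <= M%:E)%E <-> forall n, rho_partial n x <= M.
Proof.
split=> [xM n|xM].
  rewrite -lee_fin (le_trans _ xM)// /rho_partial -sumEFin.
  by apply: nneseries_lim_ge => k _ _; rewrite lee_fin powR_ge0.
apply: lime_le.
  by apply: is_cvg_nneseries => k _ _; rewrite lee_fin powR_ge0.
by apply: nearW => n; rewrite sumEFin lee_fin; exact: xM.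
Qed.

Lemma window_mean_ge0 k x : (1 <= k)%N -> 0 <= window_mean k x.
Proof.
by move=> k1; rewrite mulr_ge0 ?sumr_ge0// invr_ge0 ltW// lambda_gt0.
Qed.

Lemma window_meanZ k a x : window_mean k (a *: x) = `|a| * window_mean k x.
Proof.
rewrite /window_mean [RHS]mulrCA [in RHS]mulr_sumr; congr (_ * _).
by apply: eq_bigr => j _; rewrite -normrM.
Qed.

Lemma window_meanD k x y : (1 <= k)%N ->
  window_mean k (x + y) <= window_mean k x + window_mean k y.
Proof.
move=> k1; rewrite -mulrDr ler_wpM2l ?invr_ge0 ?(ltW (lambda_gt0 k1))//.
by rewrite -big_split/=; apply: ler_sum => j _; exact: ler_normD.
Qed.

(** The index k belongs to its own window exactly because lambda k >= 1. *)
Lemma coord_le_window_mean k x : (1 <= k)%N ->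
  `|x k| <= lambda k * window_mean k x.
Proof.
move=> k1; rewrite mulrA divff ?gt_eqF ?lambda_gt0// mul1r.
rewrite (bigD1 (@ord_max k))/=; first by rewrite lerDl sumr_ge0.
by rewrite /I_ inE k1 leqnn andbT/= -addrA gerDl addrC subr_le0 lambda_ge1.
Qed.

Lemma cvg_window_mean (F : set_system (nat -> R)) x k : ProperFilter F ->
  (forall j, (fun y => y j) @ F --> x j) ->
  window_mean k y @[y --> F] --> window_mean k x.
Proof.
move=> FF Fx; apply: cvgM; first exact: cvg_cst.
by apply: cvg_big => [|j _]; [exact: add_continuous|apply: cvg_norm]; exact: Fx.
Qed.

Lemma rho_partial_convex n t x y : 0 <= t <= 1 ->
  rho_partial n (t *: x + (1 - t) *: y) <=
  t * rho_partial n x + (1 - t) * rho_partial n y.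
Proof.
move=> t01; have [t0 t1] := andP t01.
rewrite /rho_partial !mulr_sumr -big_split/= !big_nat.
apply: ler_sum => k /andP[k1 _].
apply: (le_trans _ (powR_convex_comb t01 (window_mean_ge0 x k1)
  (window_mean_ge0 y k1) (p_ge1 k1))).
have p0 : 0 <= p k by rewrite (le_trans ler01)// p_ge1.
have t'0 : 0 <= 1 - t by rewrite subr_ge0.
apply: ge0_ler_powR => //.
- by rewrite nnegrE window_mean_ge0.
- by rewrite nnegrE addr_ge0// mulr_ge0// window_mean_ge0.
- apply: le_trans (window_meanD _ _ k1) _.
  by rewrite !window_meanZ !ger0_norm.
Qed.

Lemma window_mean0 k : window_mean k 0 = 0.
Proof. by rewrite -(scale0r 0) window_meanZ normr0 mul0r. Qed.

Lemma rho_partial0 n : rho_partial n 0 = 0.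
Proof.
rewrite /rho_partial big_nat big1// => k /andP[k1 _].
by rewrite window_mean0 powR0// gt_eqF// (lt_le_trans ltr01)// p_ge1.
Qed.

(** If a window mean exceeded 1, so would its p k-th power, which is a single
    term of the partial sums. *)
Lemma window_mean_le1 k x : (1 <= k)%N -> (forall n, rho_partial n x <= 1) ->
  window_mean k x <= 1.
Proof.
move=> k1 /(_ k.+1); apply: contraTT; rewrite -!ltNge => k_gt1.
rewrite /rho_partial big_nat_recr//=.
rewrite (lt_le_trans k_gt1)// (le_trans (le1r_powR (ltW k_gt1) (p_ge1 k1)))//.
by rewrite lerDr sumr_ge0// => i _; exact: powR_ge0.
Qed.

(** The coordinate at 0 is invisible to rho, so the ball would be unbounded in
    that direction without the constraint of [ell0]. *)
Definition rho_ball : set (nat -> R) :=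
  [set x | ell0 x /\ forall n, rho_partial n x <= 1].

Let ballB0 : rho_ball 0.
Proof. by split=> // n; rewrite rho_partial0. Qed.

Let ballBN x : rho_ball x -> rho_ball (- x).
Proof.
move=> [x0 xB]; split=> [|n]; first by apply: (etrans (congr1 -%R x0)); exact: oppr0.
apply: le_trans (xB n); rewrite /rho_partial ler_sum// => k _.
by rewrite -scaleN1r window_meanZ normrN1 mul1r.
Qed.

Let ballB_convex (t : R) x y : 0 <= t <= 1 ->
  rho_ball x -> rho_ball y -> rho_ball (t *: x + (1 - t) *: y).
Proof.
move=> t01 [x0 xB] [y0 yB]; split=> [|n].
  suff: t * x 0%N + (1 - t) * y 0%N = 0 by [].
  by rewrite (x0 : x 0%N = 0) (y0 : y 0%N = 0) !mulr0 addr0.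
apply: le_trans (rho_partial_convex _ _ _ t01) _.
have [t0 t1] := andP t01.
rewrite -[leRHS](subrKC t) lerD//.
- by rewrite ler_piMr.
- by rewrite ler_piMr// subr_ge0.
Qed.

Let ballB_bounded j : exists2 c, 0 <= c & forall x, rho_ball x -> `|x j| <= c.
Proof.
case: j => [|k]; first by exists 0 => // x [-> _]; rewrite normr0.
have l0 := lambda_gt0 (ltn0Sn k); exists (lambda k.+1); first exact: ltW.
move=> x [_ xB]; apply: le_trans (coord_le_window_mean _ (ltn0Sn k)) _.
by rewrite ler_piMr ?(ltW l0)// window_mean_le1.
Qed.

Let ballB_closed (F : set_system (nat -> R)) x : ProperFilter F ->
  F rho_ball -> (forall j, (fun y => y j) @ F --> x j) -> rho_ball x.
Proof.
move=> FF FB Fx; split=> [|n].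
  apply: (cvg_unique _ (Fx 0%N)) => //; apply: cvg_near_cst.
  by move: FB; apply: filterS => y [-> _].
have Fn : rho_partial n y @[y --> F] --> rho_partial n x.
  rewrite /rho_partial big_nat; under eq_fun do rewrite big_nat.
  apply: cvg_big => [|k /andP[k1 _]]; first exact: add_continuous.
  apply: cvg_powR_ge0.
  - by rewrite (lt_le_trans ltr01)// p_ge1.
  - by move=> y; exact: window_mean_ge0.
  - exact: cvg_window_mean.
apply: (cvgr_to_le Fn).
by move: FB; apply: filterS => y [_]; exact.
Qed.

Definition rho_disc : banach_disc R nat :=
  @BanachDisc R nat rho_ball ballB0 ballBN ballB_convex ballB_bounded ballB_closed.

Lemma disc_radii_rhoE x : ell0 x ->
  disc_radii rho_disc x =
  [set s | 0 < s /\ (rho lambda p (s^-1 *: x) <= 1)%E].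
Proof.
move=> x0; apply/seteqP; split=> s [s0 xs]; split=> //.
  by apply/rho_leP => n; exact: (proj2 xs).
split; first by apply: (etrans (congr1 ( *%R s^-1) x0)); exact: mulr0.
by move=> n; apply/rho_leP: n.
Qed.

(** A finite value M of rho at s *: x is brought below 1 by shrinking the vector
    by the factor 1 / (1 + M), by convexity between s *: x and 0. *)
Lemma V_rhoE x : V_rho lambda p x <-> x \in disc_span rho_disc.
Proof.
split=> [[x0 [s [s0 xs]]]|/disc_spanP[s [s0 [x0 xs]]]].
  apply/disc_spanP; rewrite disc_radii_rhoE//.
  have [M M0 xM] : exists2 M, 0 <= M & (rho lambda p (s *: x) <= M%:E)%E.
    exists (fine (rho lambda p (s *: x))).
      by rewrite fine_ge0// nneseries_ge0// => k _ _; rewrite lee_fin powR_ge0.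
    rewrite fineK// ge0_fin_numE// nneseries_ge0// => k _ _.
    by rewrite lee_fin powR_ge0.
  have M10 : 0 < 1 + M by rewrite ltr_pwDl.
  exists ((1 + M) / s); split; first by rewrite divr_gt0.
  apply/rho_leP => n.
  rewrite invf_div mulrC -scalerA.
  have t01 : 0 <= (1 + M)^-1 <= 1.
    by rewrite invr_ge0 (ltW M10)/= invf_le1// lerDl.
  have := rho_partial_convex n (s *: x) 0 t01.
  rewrite scaler0 addr0 rho_partial0 mulr0 addr0 => /le_trans; apply.
  rewrite ler_pdivrMl// mulr1 (le_trans (proj1 (rho_leP _ _) xM n))//.
  by rewrite lerDr.
have {}x0 : ell0 x.
  move/eqP: x0; rewrite [X in X == _]/(_ * x 0%N) mulf_eq0 invr_eq0 gt_eqF//=.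
  by move/eqP.
split=> //; exists s^-1; split; first by rewrite invr_gt0.
by apply: (@le_lt_trans _ _ 1%:E); [exact/rho_leP|exact: ltry].
Qed.

Lemma luxemburgE x : V_rho lambda p x ->
  luxemburg lambda p x = (gauge rho_disc x)%:E.
Proof.
move=> xV; have [x0 _] := xV; rewrite /luxemburg -disc_radii_rhoE//.
apply: ereal_inf_EFin; first exact: disc_radii_lb.
exact/disc_spanP/V_rhoE.
Qed.

End modular.

Theorem theorem4p5 (R : realType) (lambda p : nat -> R)
    (lambda_gt0 : forall k, (1 <= k)%N -> 0 < lambda k)
    (lambda_nd : forall k l, (1 <= k)%N -> (k <= l)%N -> lambda k <= lambda l)
    (lambda_oo : lambda k @[k --> \oo] --> +oo)
    (lambda1 : lambda 1%N = 1)
    (lambdaS : forall k, (1 <= k)%N -> lambda k.+1 <= lambda k + 1)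
    (p_bounded : exists M : R, forall k, (1 <= k)%N -> `|p k| <= M)
    (p_gt1 : forall k, (1 <= k)%N -> 1 < p k) :
  banach_space_for (V_rho lambda p) (luxemburg lambda p).
Proof.
have lambda_ge1 k : (1 <= k)%N -> 1 <= lambda k.
  by move=> k1; rewrite -lambda1 lambda_nd.
have p_ge1 k : (1 <= k)%N -> 1 <= p k by move=> /p_gt1/ltW.
apply: (@banach_space_for_gauge _ _ (rho_disc lambda_ge1 p_ge1)).
- exact: V_rhoE.
- exact: luxemburgE.
Qed.
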